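(* Let $d\ge1$, $\lambda=(d-1)/2$, and let $P_{\eta,\rho}$, $\eta\in\mathbb{S}_d$, $\rho\in I$, be probability distributions on $\mathbb{S}_d$ with densities $x\mapsto g_\rho(\eta^{t}x)$ with respect to $\mathrm{unif}(\mathbb{S}_d)$, where $g_\rho\in L^2([-1,1],\nu_d)$ and $\beta(\rho)=\sum_{n=1}^\infty|\beta_n(\rho)|<\infty$. Suppose that $\beta_n(\rho)\ge0$ for all $n\in\mathbb{N}$ and that $\beta(\rho)\le1$. Let $\eta\in\mathbb{S}_d$. Then $P_{\eta,\rho}$ has the discrete mixture expansion $$P_{\eta,\rho}=\sum_{n=0}^\infty w_\rho(n)\,\Delta^\lambda_{n,\eta},$$ with $w_\rho(0)=1-\beta(\rho)$ and $w_\rho(n)=\beta_n(\rho)$ for all $n\in\mathbb{N}$.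
   Context: $\mathbb{S}_d=\{x\in\mathbb{R}^{d+1}:\|x\|=1\}$ with uniform distribution $\mathrm{unif}(\mathbb{S}_d)$; $\eta^{t}x$ is the Euclidean inner product; $I\subset[0,\infty)$ is an interval; $\mathbb{N}=\{1,2,\dots\}$. $\nu_d$ is the push-forward of $\mathrm{unif}(\mathbb{S}_d)$ under $x\mapsto\eta^{t}x$, a probability measure on $[-1,1]$ not depending on $\eta$. On $L^2([-1,1],\nu_d)$ put $\langle f,g\rangle_\lambda=\int fg\,d\nu_d$, $\|f\|_\lambda=\langle f,f\rangle_\lambda^{1/2}$. $D_n^0=T_n$ is the Chebyshev polynomial of the first kind of degree $n$; for $\lambda>0$, $D_n^\lambda=C_n^\lambda/C_n^\lambda(1)$ with $C_n^\lambda$ the Gegenbauer (ultraspherical) polynomial of degree $n$. $(D_n^\lambda)_{n\ge0}$ is a complete orthogonal sequence in $L^2([-1,1],\nu_d)$. Set $\beta_n(\rho)=\langle g_\rho,D_n^\lambda\rangle_\lambda\,\|D_n^\lambda\|_\lambda^{-2}$ for $n\in\mathbb{N}$. $\Delta^\lambda_{0,\eta}=\mathrm{unif}(\mathbb{S}_d)$, and for $n\in\mathbb{N}$, $\Delta^\lambda_{n,\eta}$ is the probability distribution on $\mathbb{S}_d$ with $\mathrm{unif}(\mathbb{S}_d)$-density $x\mapsto1+D_n^\lambda(\eta^{t}x)$. *)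

(* Defs.v *)
From HB Require Import structures.
From mathcomp Require Import all_boot all_order all_algebra.
From mathcomp Require Import all_classical all_reals all_analysis.

Set Implicit Arguments.
Unset Strict Implicit.
Unset Printing Implicit Defensive.

Import Order.TTheory GRing.Theory Num.Theory.
Import numFieldNormedType.Exports.

Local Open Scope classical_set_scope.
Local Open Scope ring_scope.

Definition dot {R : realType} {n : nat} (x y : 'rV[R]_n) : R :=
  (x *m y^T) 0 0.

(* The condition is stated on the squared norm: the library norm on 'rV is the
   sup norm, not the Euclidean one. *)
Definition sphere_set (R : realType) (d : nat) : set 'rV[R]_d.+1 :=
  [set x | dot x x = 1].
Arguments sphere_set : clear implicits.

Definition sphere_space (R : realType) (d : nat) : Type := sphere_set R d.

Lemma north_subproof (R : realType) (d : nat) :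
  (delta_mx 0 0 : 'rV[R]_d.+1) \in sphere_set R d.
Proof.
rewrite inE /sphere_set /= /dot mxE (bigD1 ord0)//= big1 ?addr0.
  by rewrite !mxE eqxx mulr1.
by move=> i /negPf i0; rewrite !mxE i0 mulr0.
Qed.

HB.instance Definition _ (R : realType) (d : nat) :=
  Topological.copy (sphere_space R d) (sphere_set R d).
HB.instance Definition _ (R : realType) (d : nat) :=
  isPointed.Build (sphere_space R d)
    (exist _ (delta_mx 0 0) (north_subproof R d)).

(* S_d with its Borel sigma-algebra, for the topology induced by R^(d+1) *)
Definition sphere (R : realType) (d : nat) :=
  g_sigma_algebraType (@open (sphere_space R d)).

Section SphereTheory.
Context {R : realType} {d : nat}.
Implicit Types x eta : sphere R d.

Definition coords x : 'rV[R]_d.+1 := set_val (x : sphere_set R d).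

Lemma coordsP x : dot (coords x) (coords x) = 1.
Proof. exact: (@set_valP _ (sphere_set R d) x). Qed.

Definition north : sphere R d := point.

Definition sdot eta x : measurableTypeR R := dot (coords eta) (coords x).

Lemma continuous_sdot (eta : sphere_space R d) :
  continuous (sdot eta : sphere_space R d -> R).
Proof.
move=> x; rewrite /sdot /dot.
have -> : (fun y : sphere_space R d => (coords eta *m (coords y)^T) 0 0) =
    (fun y : sphere_space R d =>
       \sum_j coords eta 0 j * (fun v : 'rV[R]_d.+1 => v 0 j) (coords y)).
  by apply/funext => y; rewrite mxE; apply: eq_bigr => j _; rewrite mxE.
apply: continuous_big => [|j _ y]; first exact: add_continuous.
apply: (@continuous_comp (sphere_space R d) _ _ coords
  (fun v : 'rV[R]_d.+1 => coords eta 0 j * v 0 j)).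
  exact: (@initial_continuous (sphere_set R d) _ set_val).
apply: (@continuous_comp _ _ _ (fun v : 'rV[R]_d.+1 => v 0 j)).
  exact: coord_continuous.
exact: mulrl_continuous.
Qed.

Lemma measurable_sdot eta : measurable_fun [set: sphere R d] (sdot eta).
Proof.
apply: (measurability _ (measurable_realfun.RGenOpens.measurableE R)).
move=> _ [_ [a [b ->] <-]]; rewrite setTI; apply: sub_sigma_algebra.
by move/continuousP: (@continuous_sdot eta); apply; exact: interval_open.
Qed.

HB.instance Definition _ eta :=
  isMeasurableFun.Build _ _ (sphere R d) (measurableTypeR R) (sdot eta)
    (measurable_sdot eta).

Lemma rotate_subproof (Q : 'M[R]_d.+1) (hQ : Q *m Q^T = 1%:M) x :
  coords x *m Q \in sphere_set R d.
Proof.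
rewrite inE /sphere_set /= /dot trmx_mul mulmxA -(mulmxA _ Q) hQ mulmx1.
exact: coordsP.
Qed.

Definition rotate (Q : 'M[R]_d.+1) (hQ : Q *m Q^T = 1%:M) x : sphere R d :=
  exist _ (coords x *m Q) (rotate_subproof hQ x).

(* unif(S_d) is the unique Borel probability measure on S_d that is invariant
   under the orthogonal group O(d+1). *)
Definition is_unif (mu : probability (sphere R d) R) : Prop :=
  forall (Q : 'M[R]_d.+1) (hQ : Q *m Q^T = 1%:M) (A : set (sphere R d)),
    measurable A -> mu (rotate hQ @^-1` A) = mu A.

(* nu_d, as a probability measure on R carried by [-1, 1]; by invariance of mu
   the pole north may be replaced by any other point of the sphere. *)
Definition nu (mu : probability (sphere R d) R) :
  probability (measurableTypeR R) R := distribution mu (sdot north).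

End SphereTheory.

Section Ultraspherical.
Context {R : realType}.

Fixpoint chebyshevT (n : nat) : {poly R} :=
  match n with
  | 0%N => 1
  | 1%N => 'X
  | (m.+1 as k).+1 => 2%:R *: ('X * chebyshevT k) - chebyshevT m
  end.

(* three-term recurrence
   (k+1) C_(k+1) = 2 (k + lambda) X C_k - (k + 2 lambda - 1) C_(k-1) *)
Fixpoint gegenbauer (lambda : R) (n : nat) : {poly R} :=
  match n with
  | 0%N => 1
  | 1%N => (2%:R * lambda) *: 'X
  | (m.+1 as k).+1 => k.+1%:R^-1 *:
      ((2%:R * (k%:R + lambda)) *: ('X * gegenbauer lambda k)
       - (k%:R + 2%:R * lambda - 1) *: gegenbauer lambda m)
  end.

Definition Dpoly (lambda : R) (n : nat) : {poly R} :=
  if lambda == 0 then chebyshevT n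
  else (gegenbauer lambda n).[1]^-1 *: gegenbauer lambda n.

End Ultraspherical.

Section Expansion.
Context {R : realType}.

Definition inner (m : probability (measurableTypeR R) R) (f g : R -> R) : R :=
  (\int[m]_x (f x * g x))%R.

Definition norm2 (m : probability (measurableTypeR R) R) (f : R -> R) : R :=
  Num.sqrt (inner m f f).

Definition beta (m : probability (measurableTypeR R) R) (lambda : R)
    (g : R -> R) (n : nat) : R :=
  inner m g (horner (Dpoly lambda n))
  * norm2 m (horner (Dpoly lambda n)) ^- 2.

Definition beta_total (m : probability (measurableTypeR R) R) (lambda : R)
    (g : R -> R) : \bar R :=
  (\sum_(1 <= n <oo) `|beta m lambda g n|%:E)%E.

Definition weight (m : probability (measurableTypeR R) R) (lambda : R)
    (g : R -> R) (n : nat) : R :=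
  if n == 0%N then 1 - fine (beta_total m lambda g) else beta m lambda g n.

Context {disp : measure_display} {T : measurableType disp}.

Definition has_density (mu P : probability T R) (f : T -> R) : Prop :=
  forall A : set T, measurable A -> P A = (\int[mu]_(x in A) (f x)%:E)%E.

Definition mixture_expansion (P : probability T R) (w : nat -> R)
    (Q : nat -> probability T R) : Prop :=
  [/\ forall n, 0 <= w n,
      (\sum_(0 <= n <oo) (w n)%:E = 1)%E &
      forall A : set T, measurable A ->
        P A = (\sum_(0 <= n <oo) (w n)%:E * Q n A)%E].

End Expansion.

(* Q is the distribution Delta^lambda_(n, eta) *)
Definition is_Delta (R : realType) (d : nat) (mu : probability (sphere R d) R)
    (lambda : R) (n : nat) (eta : sphere R d) (Q : probability (sphere R d) R) :
    Prop :=
  if n == 0%N then forall A, measurable A -> Q A = mu A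
  else has_density mu Q (fun x => 1 + (Dpoly lambda n).[sdot eta x]).

(* Main.v *)
(* Invariance of unif(S_d) under orthogonal maps determines the moments of nu_d:
   expanding E[(x_0 + u x_j)^(2q)] = (1 + u^2)^q E[x_0^(2q)] to second order in u
   and summing over j gives the integration by parts rule
     E[(1 - t^2) p'(t)] = d E[t p(t)]   for every polynomial p,
   so neither the density of nu_d nor an explicit construction of unif(S_d) is
   needed. Together with the ultraspherical differential equation this rule
   yields the orthogonality of the D_n, and the differential equation yields
   |D_n| <= 1 on [-1, 1] (Sonine), so that 1 + D_n is a probability density.
   As the weights are nonnegative, S = sum_n w_n (1 + D_n) (with w_0 alone for
   n = 0) converges absolutely, and g_rho and S have the same integral against
   every D_n, hence the same moments. Since a function on [-1, 1] is determined
   almost everywhere by its moments, g_rho = S almost everywhere, and integrating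
   the series termwise gives the expansion. *)
From HB Require Import structures.
Require Import Defs.
From mathcomp Require Import all_boot all_order all_algebra.
From mathcomp Require Import all_classical all_reals all_analysis.
From mathcomp Require Import measurable_realfun zify ring lra.

Set Implicit Arguments.
Unset Strict Implicit.
Unset Printing Implicit Defensive.

Import Order.TTheory GRing.Theory Num.Theory.
Import numFieldNormedType.Exports.

Local Open Scope classical_set_scope.
Local Open Scope ring_scope.

(** * Normalized Gegenbauer polynomials *)

Section NormalizedGegenbauer.
Context {R : realType}.
Variable a : nat.
(** Here [a] stands for [d - 1], so that lambda is [a / 2] and the factors [n + 2 lambda] of the
    classical formulas become the natural numbers [n + a]. *)
Let D : nat -> {poly R} := Dpoly (a%:R / 2).

Lemma Dpoly0 : D 0 = 1.
Proof.
rewrite /D /Dpoly; case: ifP => //= _.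
by rewrite hornerC invr1 scale1r.
Qed.

Lemma gegenbauerSS (lambda : R) n : n.+2%:R *: gegenbauer lambda n.+2 =
  (2%:R * (n.+1%:R + lambda)) *: ('X * gegenbauer lambda n.+1)
       - (n.+1%:R + 2%:R * lambda - 1) *: gegenbauer lambda n.
Proof. by rewrite scalerA divff ?pnatr_eq0// scale1r. Qed.

(** At 1 the three-term recurrence collapses: the induction hypothesis turns the lower term into a
    multiple of the middle one. These ratios of values at 1 drive the normalization in [DpolySS]. *)
Lemma gegenbauer1S (lambda : R) n :
  n.+1%:R * (gegenbauer lambda n.+1).[1] =
  (n%:R + 2 * lambda) * (gegenbauer lambda n).[1].
Proof.
elim: n => [|n IH]; first by rewrite /= !hornerE/=.
have := congr1 (horner^~ 1) (gegenbauerSS lambda n).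
rewrite !hornerE/= => ->.
have -> : n.+1%:R + 2 * lambda - 1 = n%:R + 2 * lambda.
  by rewrite -natr1; ring.
by rewrite -IH -natr1; ring.
Qed.

Lemma gegenbauer1_gt0 (lambda : R) n : 0 < lambda ->
  0 < (gegenbauer lambda n).[1].
Proof.
move=> l0; elim: n => [|n IH]; first by rewrite /= hornerC.
rewrite -(@pmulr_rgt0 _ n.+1%:R) ?ltr0n// gegenbauer1S mulr_gt0//.
by rewrite ltr_wpDl// mulr_gt0.
Qed.

Lemma Dpoly1 : D 1 = 'X.
Proof.
rewrite /D /Dpoly; case: ifP => //= /negbT l0.
by rewrite hornerZ hornerX mulr1 scalerA mulVf ?scale1r// mulf_neq0// pnatr_eq0.
Qed.

Lemma natr_mul_scale n (p : {poly R}) : n%:R * p = n%:R *: p.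
Proof. by rewrite scaler_nat mulr_natl. Qed.

Lemma deriv_natrM n (p : {poly R}) : (n%:R * p)^`() = n%:R * p^`().
Proof. by rewrite !mulr_natl derivMn. Qed.

(** Dividing the Gegenbauer recurrence by the values at 1 gives a form that at [a = 0] is the
    Chebyshev recurrence. With [Dpoly0] and [Dpoly1] it treats both cases of [Dpoly] uniformly from
    here on. *)
Lemma DpolySS n : (n.+1 + a)%:R * D n.+2 =
  (2 * n.+1 + a)%:R * ('X * D n.+1) - n.+1%:R * D n.
Proof.
rewrite !natr_mul_scale /D /Dpoly; case: ifPn => [|l0].
  rewrite mulf_eq0 invr_eq0 !pnatr_eq0 orbF => /eqP ->.
  by rewrite /= !addn0 !scalerBr !scalerA !natrM mulrC.
have lgt0 : 0 < a%:R / 2 :> R.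
  by rewrite lt0r l0 divr_ge0.
set l := a%:R / 2; set C := gegenbauer l.
have al : a%:R = 2 * l by rewrite /l mulrC divfK.
have C0 k : (C k).[1] != 0 by rewrite gt_eqF// gegenbauer1_gt0.
have e1 := gegenbauer1S l n.+1; have e0 := gegenbauer1S l n.
rewrite -/C in e0 e1.
have n20 : n.+2%:R != 0 :> R by rewrite pnatr_eq0.
have n10 : n.+1%:R != 0 :> R by rewrite pnatr_eq0.
have E2 : (C n.+2).[1] = (n.+1%:R + 2 * l) * (C n.+1).[1] / n.+2%:R.
  by rewrite -e1 mulrC mulKf.
have S2 : C n.+2 = n.+2%:R^-1 *: (n.+2%:R *: C n.+2) by rewrite scalerK.
rewrite E2 S2 gegenbauerSS -/C -(scalerAr _ 'X) !scalerA scalerBr !scalerA.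
have nl0 : n.+1%:R + 2 * l != 0 by rewrite gt_eqF// ltr_wpDl// mulr_gt0.
have n20' : 2 + n%:R != 0 :> R by rewrite -natrD pnatr_eq0.
have n10' : 1 + n%:R != 0 :> R by rewrite nat1r pnatr_eq0.
have nl0'' : 1 + n%:R + 2 * l != 0 by rewrite nat1r.
congr (_ *: _ - _ *: _).
  rewrite natrD natrD natrM al; field.
  by rewrite C0 n20' nl0''.
have nl0' : n%:R + 2 * l != 0 by rewrite gt_eqF// ltr_wpDl// mulr_gt0.
have -> : n.+1%:R + 2 * l - 1 = n%:R + 2 * l by rewrite -natr1; ring.
have -> : (C n.+1).[1] = (n%:R + 2 * l) * (C n).[1] / n.+1%:R.
  by rewrite -e0 mulrC mulKf.
rewrite natrD al; field.
by rewrite C0 n20' n10' nl0' nl0''.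
Qed.

Lemma Dpoly_at1 n : (D n).[1] = 1 /\ (D n.+1).[1] = 1.
Proof.
elim: n => [|n [IH0 IH1]]; first by rewrite Dpoly0 Dpoly1 hornerC hornerX.
split=> //; have := congr1 (horner^~ 1) (DpolySS n).
rewrite /= !natr_mul_scale !(hornerD, hornerN, hornerZ, hornerM, hornerX).
rewrite IH0 IH1 => e.
have n0 : (n.+1 + a)%:R != 0 :> R by rewrite pnatr_eq0.
apply: (mulfI n0).
by rewrite e; ring.
Qed.

Lemma Dpoly_atN1 n : (D n).[-1] = (-1) ^+ n /\ (D n.+1).[-1] = (-1) ^+ n.+1.
Proof.
elim: n => [|n [IH0 IH1]]; first by rewrite Dpoly0 Dpoly1 hornerC hornerX.
split=> //; have := congr1 (horner^~ (-1)) (DpolySS n).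
rewrite /= !natr_mul_scale !(hornerD, hornerN, hornerZ, hornerM, hornerX).
rewrite IH0 IH1 => e.
have n0 : (n.+1 + a)%:R != 0 :> R by rewrite pnatr_eq0.
by apply: (mulfI n0); rewrite e !exprS; ring.
Qed.

(** The lowering and raising relations support each other in one induction. The new raising relation
    is the old lowering relation modulo [DpolySS]; the new lowering relation comes from
    differentiating [DpolySS] and inserting both old ones. *)
Lemma Dpoly_structure n :
  (1 - 'X^2) * (D n.+1)^`() = n.+1%:R * (D n - 'X * D n.+1) /\
  (1 - 'X^2) * (D n)^`() = (n + a)%:R * ('X * D n - D n.+1).
Proof.
elim: n => [|n [IH1 IH0]].
  by rewrite Dpoly0 Dpoly1 derivC derivX !mulr1 mulr0 subrr mulr0 mul1r expr2.
have n0 : (n.+1 + a)%:R != 0 :> {poly R} by rewrite -polyC_natr polyC_eq0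
  pnatr_eq0.
have e := DpolySS n.
split; last first.
  rewrite IH1 [RHS]mulrBr e; ring.
apply: (mulfI n0); have := congr1 (fun p => (1 - 'X^2) * p^`()) e.
rewrite /= derivB !deriv_natrM derivM derivX mul1r => {}e.
rewrite mulrCA e {e}.
transitivity ((2 * n.+1 + a)%:R *
    ((1 - 'X^2) * D n.+1 + 'X * ((1 - 'X^2) * (D n.+1)^`()))
  - n.+1%:R * ((1 - 'X^2) * (D n)^`())).
  by ring.
rewrite IH1 IH0.
have e := DpolySS n.
transitivity (n.+2%:R *
  ((n.+1 + a)%:R * D n.+1 - 'X * ((n.+1 + a)%:R * D n.+2))); last by ring.
rewrite e; ring.
Qed.

Lemma Dpoly_ode n :
  (1 - 'X^2) * (D n)^`()^`() - a.+1%:R * ('X * (D n)^`())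
  + (n * (n + a))%:R * D n = 0.
Proof.
case: n => [|n]; first by rewrite Dpoly0 derivC deriv0 !(mulr0,mul0r,subr0,addr0).
have X0 : (1 - 'X^2) != 0 :> {poly R}.
  by rewrite -opprB oppr_eq0 -size_poly_eq0 -polyC1 size_XnsubC.
apply: (mulfI X0); rewrite mulr0.
have [e1 _] := Dpoly_structure n.
have [_ e0] := Dpoly_structure n.
have dX : (1 - 'X^2)^`() = - ('X *+ 2) :> {poly R}.
  by rewrite derivB derivC derivXn sub0r expr1.
have := congr1 (@deriv R) e1.
rewrite deriv_natrM (derivM (1 - 'X^2)) dX (derivB (D n)) (derivM 'X).
rewrite derivX mul1r => e2.
transitivity ((1 - 'X^2) *
    (- ('X *+ 2) * (D n.+1)^`() + (1 - 'X^2) * ((D n.+1)^`())^`())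
  + (1 - a%:R) * 'X * ((1 - 'X^2) * (D n.+1)^`())
  + (1 - 'X^2) * (n.+1 * (n.+1 + a))%:R * D n.+1).
  by ring.
have -> : (1 - 'X^2) *
    (- ('X *+ 2) * (D n.+1)^`() + (1 - 'X^2) * ((D n.+1)^`())^`())
  = n.+1%:R * ((1 - 'X^2) * (D n)^`() - (1 - 'X^2) * D n.+1
    - 'X * ((1 - 'X^2) * (D n.+1)^`())).
  rewrite e2; ring.
by rewrite e0 e1; ring.
Qed.
End NormalizedGegenbauer.

(** * The bound |D_n| <= 1 on [-1, 1] *)

Section DpolyBound.
Context {R : realType}.
Variable a : nat.
Let D : nat -> {poly R} := Dpoly (a%:R / 2).

Lemma horner_MVT (p : {poly R}) (x y : R) : x <= y ->
  exists2 c, x <= c <= y & p.[y] - p.[x] = p^`().[c] * (y - x).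
Proof.
move=> xy; have [|c cxy e] := @MVT_segment R (horner p) (horner p^`()) x y xy.
- by apply: continuous_subspaceT; exact: continuous_horner.
- by exists c => //; move: cxy; rewrite in_itv.
Qed.

(* Sonine: the derivative [2 a t D_n'(t)^2] of [F] has the sign of [t]. *)
Lemma Dpoly_le1 n (t : R) : -1 <= t <= 1 -> `|(D n).[t]| <= 1.
Proof.
case: n => [_|n /andP[t1 t2]]; first by rewrite /D Dpoly0 hornerC normr1.
pose N : nat := n.+1 * (n.+1 + a).
pose F := N%:R * (D n.+1 * D n.+1) + (1 - 'X^2) * ((D n.+1)^`() * (D n.+1)^`()).
have F' : F^`() = (2 * a)%:R * ('X * ((D n.+1)^`() * (D n.+1)^`())).
  rewrite /F derivD deriv_natrM !derivM.
  have -> : (1 - 'X^2)^`() = - ('X *+ 2) :> {poly R}.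
    by rewrite derivB derivC derivXn sub0r expr1.
  transitivity (2%:R * (D n.+1)^`() * ((1 - 'X^2) * (D n.+1)^`()^`()
    - a.+1%:R * ('X * (D n.+1)^`()) + N%:R * D n.+1)
    + (2 * a)%:R * ('X * ((D n.+1)^`() * (D n.+1)^`()))); first by ring.
  by rewrite /D Dpoly_ode mulr0 add0r.
have F'E c : F^`().[c] = (2 * a)%:R * c * (D n.+1)^`().[c] ^+ 2.
  by rewrite F' natr_mul_scale hornerZ !hornerM hornerX expr2 !mulrA.
have FE c : F.[c] =
    N%:R * (D n.+1).[c] ^+ 2 + (1 - c ^+ 2) * (D n.+1)^`().[c] ^+ 2.
  rewrite /F natr_mul_scale !(hornerD, hornerZ, hornerM, hornerN, hornerX).
  by rewrite hornerC !expr2.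
have F1 : F.[1] = N%:R.
  by rewrite FE /D (Dpoly_at1 a n).2 expr1n subrr mul0r addr0 mulr1.
have FN1 : F.[-1] = N%:R.
  rewrite FE /D (Dpoly_atN1 a n).2 -exprM mulnC exprM sqrrN !expr1n.
  by rewrite subrr mul0r addr0 mulr1.
(* On each half of [-1, 1], [F] is at most its value N at the outer endpoint. Dropping the
   nonnegative derivative term of [F] then leaves N D(t)^2 <= N. *)
have Ft : F.[t] <= N%:R.
  have [t0|t0] := leP 0 t.
    have [c /andP[tc c1] e] := horner_MVT F t2.
    have c0 : 0 <= c := le_trans t0 tc.
    by rewrite -F1 -subr_ge0 e F'E mulr_ge0 ?subr_ge0// mulr_ge0 ?sqr_ge0//
      mulr_ge0.
  have [c /andP[tc c1] e] := horner_MVT F t1.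
  rewrite -FN1 -subr_le0 e F'E -mulrA mulr_le0_ge0//.
    rewrite mulr_ge0_le0 ?ler0n//; apply: (le_trans c1); exact: ltW.
  by rewrite mulr_ge0 ?sqr_ge0 ?subr_ge0.
have N0 : 0 < N%:R :> R by rewrite ltr0n.
rewrite -(@ler_pXn2r _ 2)//= ?nnegrE// real_normK ?num_real// expr1n.
rewrite -(ler_pM2l N0) mulr1; apply: le_trans Ft; rewrite FE lerDl.
rewrite mulr_ge0 ?sqr_ge0// subr_ge0 -(expr1n _ 2) -(real_normK (num_real t)).
by rewrite ler_pXn2r// ?nnegrE// ler_norml t1.
Qed.
End DpolyBound.

(** * The sphere and its uniform distribution *)

Section Sphere.
Context {R : realType} {d : nat}.
Implicit Types eta x : sphere R d.

Lemma dotE n (u v : 'rV[R]_n) : dot u v = \sum_j u 0 j * v 0 j.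
Proof. by rewrite /dot mxE; apply: eq_bigr => j _; rewrite mxE. Qed.

Lemma dotC n (u v : 'rV[R]_n) : dot u v = dot v u.
Proof. by rewrite !dotE; apply: eq_bigr => j _; rewrite mulrC. Qed.

Lemma dotDl n (u v w : 'rV[R]_n) : dot (u + v) w = dot u w + dot v w.
Proof. by rewrite /dot mulmxDl mxE. Qed.

Lemma dotZl n c (u w : 'rV[R]_n) : dot (c *: u) w = c * dot u w.
Proof. by rewrite /dot -scalemxAl mxE. Qed.

Lemma dotDr n (u v w : 'rV[R]_n) : dot w (u + v) = dot w u + dot w v.
Proof. by rewrite !(dotC w) dotDl. Qed.

Lemma dotZr n c (u w : 'rV[R]_n) : dot w (c *: u) = c * dot w u.
Proof. by rewrite !(dotC w) dotZl. Qed.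

Lemma dot_delta n j (u : 'rV[R]_n) : dot (delta_mx 0 j) u = u 0 j.
Proof.
rewrite dotE (bigD1 j)//= big1 ?addr0.
  by rewrite mxE !eqxx mul1r.
by move=> i /negPf ij; rewrite mxE ij mul0r.
Qed.

Lemma dot_ge0 n (u : 'rV[R]_n) : 0 <= dot u u.
Proof. by rewrite dotE sumr_ge0// => j _; rewrite -expr2 sqr_ge0. Qed.

Lemma dot_eq0 n (u : 'rV[R]_n) : (dot u u == 0) = (u == 0).
Proof.
apply/idP/eqP => [|->]; last by rewrite /dot mul0mx mxE.
rewrite dotE psumr_eq0 => [/allP u0|j _]; last by rewrite -expr2 sqr_ge0.
apply/rowP => j; apply/eqP; rewrite mxE.
by have := u0 j (mem_index_enum _); rewrite -expr2 sqrf_eq0.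
Qed.

(** For unit vectors, the squared lengths of the sum and the difference are 2 + 2s and 2 - 2s, both
    nonnegative. *)
Lemma sdot_itv eta x : -1 <= (sdot eta x : R) <= 1.
Proof.
have := dot_ge0 (coords eta + coords x).
have := dot_ge0 (coords eta + (-1) *: coords x).
rewrite !(dotDl, dotDr, dotZl, dotZr) !coordsP (dotC (coords x)) -/(sdot eta x).
move: (sdot eta x : R) => s; lra.
Qed.

Lemma sdot_le1 eta x : `|sdot eta x : R| <= 1.
Proof. by rewrite ler_norml sdot_itv. Qed.

Definition sphere_point (v : 'rV[R]_d.+1) (v1 : dot v v = 1) : sphere R d :=
  exist _ v (mem_set v1).

Lemma coords_sphere_point v (v1 : dot v v = 1) : coords (sphere_point v1) = v.
Proof. by []. Qed.

(** The reflection in the hyperplane orthogonal to [u - e] swaps the two unit vectors; if they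
    coincide, the identity serves. *)
Lemma householder n (u e : 'rV[R]_n) : dot u u = 1 -> dot e e = 1 ->
  exists2 Q : 'M[R]_n, Q *m Q^T = 1%:M & u *m Q^T = e.
Proof.
move=> u1 e1; have [v vE] : exists v, v = u - e by exists (u - e).
pose s := dot v v.
have [s0|s0] := eqVneq s 0.
  exists 1%:M; rewrite trmx1 mulmx1//.
  by apply/eqP; rewrite -subr_eq0 -vE -dot_eq0; exact/eqP.
(* Hence the product of [u] with [v] is [s / 2], and the reflection subtracts exactly [v] from
   [u]. *)
have sE : s = 2 * (1 - dot u e).
  rewrite /s vE -scaleN1r !(dotDl, dotDr, dotZl, dotZr) u1 e1 (dotC e); ring.
have vv : v *m v^T = s%:M by rewrite [LHS]mx11_scalar.
pose Q := 1%:M - (2 / s) *: (v^T *m v).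
have QT : Q^T = Q by rewrite /Q linearB /= trmx1 linearZ /= trmx_mul trmxK.
exists Q; rewrite QT.
  rewrite /Q mulmxBl mul1mx mulmxBr mulmx1 -scalemxAl -scalemxAr.
  rewrite mulmxA -(mulmxA v^T) vv mul_mx_scalar scalemxAl !scalerA.
  rewrite -scalemxAl scalerA.
  have -> : 2 / s * (2 / s * s) = 2 / s + 2 / s by field.
  by rewrite scalerDl opprB !addrA addrK subrK.
rewrite /Q mulmxBr mulmx1 -scalemxAr mulmxA.
have -> : u *m v^T = (s / 2)%:M.
  rewrite [LHS]mx11_scalar -/(dot u v) vE -scaleN1r dotDr dotZr u1 sE.
  by congr (_%:M); field.
rewrite mul_scalar_mx scalerA.
have -> : 2 / s * (s / 2) = 1 by field.
by rewrite scale1r vE opprB addrC subrK.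
Qed.

Lemma sdot_rotate eta (e : sphere R d) :
  exists Q (hQ : Q *m Q^T = 1%:M), forall x, sdot eta (rotate hQ x) = sdot e x.
Proof.
have [Q hQ eQ] := householder (coordsP eta) (coordsP e).
exists Q, hQ => x; rewrite /sdot /dot.
by rewrite [coords (rotate hQ x)]/= trmx_mul mulmxA eQ.
Qed.

End Sphere.

(** * Integrals of bounded functions and polynomial identities *)

Section BoundedIntegrable.
Context {R : realType} {disp : measure_display} {T : measurableType disp}.
Variable P : probability T R.

Lemma integrable_bounded (f : T -> R) (M : R) : measurable_fun setT f ->
  (forall x, `|f x| <= M) -> P.-integrable setT (EFin \o f).
Proof.
move=> mf fM; apply: measurable_bounded_integrable => //.
  by rewrite (le_lt_trans (probability_le1 _ _))// ltry.
exists M; split; first exact: num_real.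
by move=> N MN x _ /=; rewrite (le_trans (fM x))// ltW.
Qed.

Lemma Rintegral_sum (I : Type) (r : seq I) (f : I -> T -> R) :
  (forall i, P.-integrable setT (EFin \o f i)) ->
  \int[P]_x (\sum_(i <- r) f i x) = \sum_(i <- r) \int[P]_x f i x.
Proof.
move=> fint; elim: r => [|i r IH].
  rewrite big_nil; under eq_Rintegral do rewrite big_nil.
  by rewrite Rintegral_cst// mul0r.
rewrite big_cons -IH -RintegralD//.
  by under eq_Rintegral do rewrite big_cons.
have -> : EFin \o (fun x => \sum_(j <- r) f j x) =
    (fun x => \sum_(j <- r) (EFin \o f j) x)%E.
  by apply/funext => x /=; rewrite sumEFin.
exact: integrable_sum.
Qed.

End BoundedIntegrable.

(** A nonzero difference would have as many distinct roots 0, 1, 2, ... as its size, which exceeds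
    its degree. *)
Lemma poly_ext (R : realType) (p q : {poly R}) :
  (forall u, p.[u] = q.[u]) -> p = q.
Proof.
move=> pq; apply/eqP; rewrite -subr_eq0; apply/negPn/negP => r0.
pose s : seq R := [seq i%:R | i <- iota 0 (size (p - q))].
have /(max_poly_roots r0) : all (root (p - q)) s.
  by apply/allP => u _; rewrite rootE hornerD hornerN pq subrr.
rewrite size_map size_iota ltnn; move=> /(_ _)/negP; apply=> //.
by rewrite map_inj_uniq ?iota_uniq// => i j /eqP; rewrite eqr_nat => /eqP.
Qed.

(** This is the second-order term used in [mean_coord2]. The constant coefficient joins the
    induction because X^2 shifts it into degree two. *)
Lemma coef2_1DX2_exp (R : realType) p :
  ((1 + 'X^2 : {poly R}) ^+ p)`_2 = p%:R.
Proof.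
suff [] : ((1 + 'X^2 : {poly R}) ^+ p)`_0 = 1 /\
  ((1 + 'X^2 : {poly R}) ^+ p)`_2 = p%:R by [].
elim: p => [|p [IH0 IH2]]; first by rewrite expr0 !coef1.
rewrite exprS mulrDl mul1r !coefD !coefXnM/= IH0 IH2.
by rewrite addr0 -natr1.
Qed.

(** * Independence of the pole *)

Section Uniform.
Context {R : realType} {d : nat}.
Variables (unif : probability (sphere R d) R) (hunif : is_unif unif).
Implicit Types eta x : sphere R d.

(** An orthogonal map relating the poles [eta] and [north] carries one preimage of [B] to the other,
    and [unif] is invariant under it. *)
Lemma nuE eta B : measurable B -> nu unif B = unif (sdot eta @^-1` B).
Proof.
move=> mB; have [Q [hQ e]] := sdot_rotate eta north.
rewrite -(hunif hQ); last by rewrite -[X in measurable X]setTI;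
  exact: measurable_sdot.
rewrite /nu /distribution /pushforward; congr (unif _).
by apply/seteqP; split=> x /=; rewrite e.
Qed.

Lemma integral_sdot eta (B : set (measurableTypeR R)) (f : R -> \bar R) :
  measurable B -> measurable_fun setT f ->
  unif.-integrable ((sdot eta : sphere R d -> measurableTypeR R) @^-1` B)
    (f \o (sdot eta : sphere R d -> R)) ->
  (\int[nu unif]_(t in B) f t =
   \int[unif]_(x in (sdot eta : sphere R d -> measurableTypeR R) @^-1` B)
     f (sdot eta x : R))%E.
Proof.
move=> mB mf intf.
rewrite -[RHS](@integral_pushforward _ _ (sphere R d) (measurableTypeR R) R
  (sdot eta) (measurable_sdot eta) unif B f)//.
by apply: eq_measure_integral => C mC _; exact: nuE.
Qed.

Lemma integrable_sdotP eta (f : R -> \bar R) : measurable_fun setT f ->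
  (nu unif).-integrable setT f <->
  unif.-integrable setT (f \o (sdot eta : sphere R d -> R)).
Proof.
move=> mf.
have e : (\int[unif]_x `|f (sdot eta x : R)| = \int[nu unif]_t `|f t|)%E.
  rewrite -(@ge0_integral_distribution _ _ (sphere R d) (measurableTypeR R) R unif
    (sdot eta) (fun t => `|f t|)%E)//; last exact: measurableT_comp.
  by apply: eq_measure_integral => B mB _; apply: esym; exact: nuE.
have mfs : measurable_fun setT (f \o (sdot eta : sphere R d -> R)).
  exact: (@measurableT_comp _ _ _ (sphere R d) (measurableTypeR R) _ f).
by split=> /integrableP[_ fi]; apply/integrableP; split=> //;
  [rewrite e|rewrite -e].
Qed.

Lemma Rintegral_sdot eta (f : R -> R) : measurable_fun setT f ->
  unif.-integrable setT (EFin \o (f \o (sdot eta : sphere R d -> R))) ->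
  \int[nu unif]_t f t = \int[unif]_x f (sdot eta x).
Proof.
move=> mf intf; rewrite /Rintegral (integral_sdot (eta := eta))//.
exact/measurable_EFinP.
Qed.

End Uniform.

(** * Moments of the uniform distribution *)

Section Moments.
Context {R : realType} {d : nat}.
Variables (unif : probability (sphere R d) R) (hunif : is_unif unif).
Implicit Types eta x : sphere R d.

Definition coord j x : R := coords x 0 j.

Lemma coordE j : exists eta, coord j = (sdot eta : sphere R d -> R).
Proof.
have dj : dot (delta_mx 0 j) (delta_mx 0 j) = 1 :> R.
  by rewrite dot_delta mxE !eqxx.
by exists (sphere_point dj); apply/funext => x; rewrite /sdot dot_delta.
Qed.

Lemma sdot_north x : sdot north x = coord ord0 x.
Proof. exact: dot_delta. Qed.

Lemma measurable_coord j : measurable_fun setT (coord j).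
Proof. by have [eta ->] := coordE j; exact: measurable_sdot. Qed.

Lemma coord_le1 j x : `|coord j x| <= 1.
Proof. by have [eta ->] := coordE j; exact: sdot_le1. Qed.

Lemma measurable_horner_sdot eta (p : {poly R}) :
  measurable_fun setT (fun x => p.[sdot eta x]).
Proof.
apply: (@measurableT_comp _ _ _ (sphere R d) (measurableTypeR R) R (horner p)).
  exact: measurable_poly.
exact: measurable_sdot.
Qed.

Lemma horner_bounded (p : {poly R}) :
  exists M, forall t : R, `|t| <= 1 -> `|p.[t]| <= M.
Proof.
exists (\sum_(i < size p) `|p`_i|) => t t1; rewrite horner_coef.
apply: le_trans (ler_norm_sum _ _ _) _; apply: ler_sum => i _.
by rewrite normrM normrX ler_piMr ?exprn_ile1.
Qed.

Lemma integrable_horner_sdot eta (p : {poly R}) :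
  unif.-integrable setT (EFin \o (fun x => p.[sdot eta x])).
Proof.
have [M pM] := horner_bounded p.
apply: (@integrable_bounded _ _ _ _ _ M); first exact: measurable_horner_sdot.
by move=> x; apply/pM/sdot_le1.
Qed.

Lemma integrable_coordM i j k l :
  unif.-integrable setT (EFin \o (fun x => coord i x ^+ k * coord j x ^+ l)).
Proof.
apply: (@integrable_bounded _ _ _ _ _ 1).
  by apply: measurable_funM; apply: measurable_funX; exact: measurable_coord.
move=> x; rewrite normrM !normrX mulr_ile1 ?exprn_ile1 ?exprn_ge0 ?coord_le1//.
Qed.

(** The moment functional of nu_d, written as an integral over the sphere. *)
Definition sphere_mean (p : {poly R}) : R := \int[unif]_x p.[sdot north x].

Lemma sphere_mean_sdot eta p : \int[unif]_x p.[sdot eta x] = sphere_mean p.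
Proof.
rewrite /sphere_mean -!(@Rintegral_sdot _ _ _ hunif _ (horner p))//;
  try exact: measurable_poly; exact: integrable_horner_sdot.
Qed.

Lemma sphere_meanD p q : sphere_mean (p + q) = sphere_mean p + sphere_mean q.
Proof.
rewrite /sphere_mean -RintegralD//; try exact: integrable_horner_sdot.
by apply: eq_Rintegral => x _; rewrite hornerD.
Qed.

Lemma sphere_meanZ c p : sphere_mean (c *: p) = c * sphere_mean p.
Proof.
rewrite /sphere_mean -RintegralZl//; try exact: integrable_horner_sdot.
by apply: eq_Rintegral => x _; rewrite hornerZ.
Qed.

Lemma sphere_meanB p q : sphere_mean (p - q) = sphere_mean p - sphere_mean q.
Proof. by rewrite -scaleN1r sphere_meanD sphere_meanZ mulN1r. Qed.

Lemma sphere_mean1 : sphere_mean 1 = 1.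
Proof.
rewrite /sphere_mean; under eq_Rintegral do rewrite hornerC.
rewrite Rintegral_cst//; have -> : fine (unif setT) = 1.
  exact: (congr1 fine (probability_setT unif)).
by rewrite mulr1.
Qed.

(** Passing to the antipodal pole flips the sign of odd powers but keeps the mean. *)
Lemma sphere_mean_odd k : odd k -> sphere_mean 'X^k = 0.
Proof.
move=> ok; have n1 : dot (- coords (north : sphere R d)) (- coords north) = 1.
  by rewrite -scaleN1r dotZl dotZr coordsP mulr1 mulrNN mulr1.
suff : sphere_mean 'X^k = - sphere_mean 'X^k.
  by move/eqP; rewrite -addr_eq0 -mulr2n mulrn_eq0 => /eqP.
rewrite -{1}(sphere_mean_sdot (sphere_point n1)) -[RHS]mulN1r -sphere_meanZ.
apply: eq_Rintegral => x _; rewrite hornerZ !hornerXn /sdot coords_sphere_point.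
by rewrite -scaleN1r dotZl exprMn -signr_odd ok expr1.
Qed.

(** The form x_0 + u x_j is the product with a vector of squared length 1 + u^2. Its normalization
    is a point of the sphere, and the mean does not depend on the pole. *)
Lemma sphere_mean_mix (j : 'I_d.+1) q (u : R) : j != ord0 ->
  \int[unif]_x ((coord ord0 x + u * coord j x) ^+ (2 * q)) =
  (1 + u ^+ 2) ^+ q * sphere_mean 'X^(2 * q).
Proof.
move=> j0; pose w : 'rV[R]_d.+1 := delta_mx 0 ord0 + u *: delta_mx 0 j.
have u0 : 0 < 1 + u ^+ 2 by rewrite ltr_pwDl ?sqr_ge0.
pose r := Num.sqrt (1 + u ^+ 2).
have r2 : r ^+ 2 = 1 + u ^+ 2 by rewrite sqr_sqrtr// ltW.
have r0 : r != 0 by rewrite sqrtr_eq0 -ltNge.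
have ww : dot w w = r ^+ 2.
  rewrite r2 !(dotDl, dotDr, dotZl, dotZr) !dot_delta !mxE !eqxx/=.
  by rewrite (negPf j0) [ord0 == j]eq_sym (negPf j0)/=; ring.
have w1 : dot (r^-1 *: w) (r^-1 *: w) = 1.
  by rewrite dotZl dotZr ww; field.
rewrite -(sphere_mean_sdot (sphere_point w1)) -RintegralZl//;
  last exact: integrable_horner_sdot.
apply: eq_Rintegral => x _; rewrite hornerXn /sdot coords_sphere_point dotZl.
rewrite /w dotDl dotZl !dot_delta -/(coord _ _) -/(coord _ _) -r2 -exprM -exprMn.
by rewrite mulrA divff// mul1r.
Qed.

(** Both sides of [sphere_mean_mix], taken with [q.+1], are polynomials in [u]; the coefficients of
    u^2 are compared. *)
Lemma mean_coord2 (j : 'I_d.+1) q : j != ord0 ->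
  (2 * q + 1)%:R * \int[unif]_x (coord ord0 x ^+ (2 * q) * coord j x ^+ 2)
  = sphere_mean 'X^(2 * q.+1).
Proof.
move=> j0.
pose c (i : nat) : R :=
  \int[unif]_x (coord ord0 x ^+ (2 * q.+1 - i) * coord j x ^+ i).
have e : \sum_(i < (2 * q.+1).+1) (c i *+ 'C(2 * q.+1, i)) *: 'X^i =
    sphere_mean 'X^(2 * q.+1) *: (1 + 'X^2) ^+ q.+1.
  apply: poly_ext => u.
  rewrite hornerZ horner_exp hornerD hornerXn hornerC mulrC.
  rewrite -(sphere_mean_mix _ _ j0).
  rewrite horner_sum; under [RHS]eq_Rintegral do rewrite exprDn.
  rewrite Rintegral_sum; last first.
    move=> i; set f := EFin \o _.
    have -> : f = (fun x => (u ^+ i *+ 'C(2 * q.+1, i))%:E *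
        (coord ord0 x ^+ (2 * q.+1 - i) * coord j x ^+ i)%:E)%E.
      apply/funext => x; rewrite /f /= -EFinM; congr (_%:E).
      by rewrite exprMn; ring.
    apply: integrableZl => //; exact: integrable_coordM.
  apply: eq_bigr => i _; rewrite hornerZ hornerXn /c -mulr_natr -mulrA mulrC.
  rewrite -RintegralZl//; last exact: integrable_coordM.
  by apply: eq_Rintegral => x _; rewrite exprMn; ring.
have := congr1 (fun p : {poly R} => p`_2) e.
rewrite /= coefZ coef2_1DX2_exp coef_sum.
have i2 : (2 < (2 * q.+1).+1)%N by lia.
rewrite (bigD1 (Ordinal i2))//= big1; last first.
  move=> i /negPf ne; rewrite coefZ coefXn.
  have -> : (2 == i :> nat) = false by rewrite eq_sym; exact: ne.
  by rewrite mulr0.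
rewrite addr0 coefZ coefXn eqxx mulr1 /c => {}e.
have q0 : q.+1%:R != 0 :> R by rewrite pnatr_eq0.
(* The factor [q.+1] also appears as the u^2 coefficient of (1 + u^2)^(q+1), and it cancels. *)
have C2 : 'C(2 * q.+1, 2) = (q.+1 * (2 * q + 1))%N by rewrite bin2; lia.
have e2 : (2 * q.+1 - 2 = 2 * q)%N by lia.
rewrite e2 C2 in e.
by apply: (mulfI q0); rewrite [RHS]mulrC -e; ring.
Qed.
End Moments.

(** * Integration by parts for polynomials *)

Section Orthogonality.
Context {R : realType} {d : nat}.
Variables (unif : probability (sphere R d) R) (hunif : is_unif unif).
Let L := sphere_mean unif.

Lemma sum_coord2 (x : sphere R d) :
  \sum_(j < d.+1 | j != ord0) coord j x ^+ 2 = 1 - coord ord0 x ^+ 2.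
Proof.
have := coordsP x; rewrite dotE (bigD1 ord0)//= => <-.
by rewrite -expr2 addrAC subrr add0r; apply: eq_bigr => j _; rewrite expr2.
Qed.

(** Sum [mean_coord2] over the [d] indices other than 0, using that the squares of those coordinates
    add up to 1 - x_0^2. *)
Lemma sphere_mean_recurrence q :
  (2 * q + 1)%:R * (L 'X^(2 * q) - L 'X^(2 * q.+1)) = d%:R * L 'X^(2 * q.+1).
Proof.
have -> : d%:R * L 'X^(2 * q.+1) = \sum_(j < d.+1 | j != ord0) L 'X^(2 * q.+1).
  rewrite sumr_const mulr_natl; congr (_ *+ _).
  by rewrite cardC1 card_ord.
under [RHS]eq_bigr => j j0 do rewrite /L -(mean_coord2 hunif _ j0).
rewrite -mulr_sumr; congr (_ * _).
rewrite -big_filter -Rintegral_sum; last by move=> j; exact: integrable_coordM.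
rewrite -sphere_meanB; apply: eq_Rintegral => x _.
rewrite big_filter -mulr_sumr sum_coord2.
rewrite hornerD hornerN !hornerXn sdot_north.
have -> : (2 * q.+1 = 2 * q + 2)%N by lia.
by rewrite exprD; ring.
Qed.

Lemma linear_form_poly0 (l : {poly R} -> R) :
  (forall p q, l (p + q) = l p + l q) -> (forall c p, l (c *: p) = c * l p) ->
  (forall k, l 'X^k = 0) -> forall p, l p = 0.
Proof.
move=> lD lZ lX p; rewrite -[p]coefK poly_def.
apply: (big_ind (fun q => l q = 0)) => [|q r q0 r0|i _].
- by rewrite -(scale0r 0) lZ mul0r.
- by rewrite lD q0 r0 addr0.
- by rewrite lZ lX mulr0.
Qed.

(** By linearity it suffices to take p = X^k. For odd k this is [sphere_mean_recurrence]; for even k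
    both sides vanish by parity. *)
Lemma sphere_mean_by_parts p :
  L ((1 - 'X^2) * p^`()) = d%:R * L ('X * p).
Proof.
apply/eqP; rewrite -subr_eq0; apply/eqP.
pose l q := L ((1 - 'X^2) * q^`()) - d%:R * L ('X * q).
apply: (@linear_form_poly0 l) => [q r|c q|k]; rewrite /l.
- by rewrite derivD !mulrDr /L !sphere_meanD; ring.
- by rewrite derivZ -!scalerAr /L !sphere_meanZ; ring.
rewrite derivXn -exprS mulrnAr mulrBl mul1r -exprD -scaler_nat /L.
rewrite sphere_meanZ sphere_meanB.
have [ok|ek] := boolP (odd k).
  pose q := k./2; have kE : k = (2 * q + 1)%N by rewrite /q; lia.
  have -> : k.-1 = (2 * q)%N by lia.
  have -> : (2 + 2 * q = 2 * q.+1)%N by lia.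
  have -> : k.+1 = (2 * q.+1)%N by lia.
  by rewrite kE sphere_mean_recurrence subrr.
rewrite (sphere_mean_odd hunif (_ : odd k.+1))// mulr0 subr0.
(* At k = 0 the truncated exponent [k.-1] is 0, hence not odd; there the factor k vanishes
   instead. *)
case: k ek => [|k ek]; first by rewrite mul0r.
by rewrite !(sphere_mean_odd hunif) ?subrr ?mulr0//; rewrite /= in ek *; lia.
Qed.

End Orthogonality.

(** * Orthogonality of the normalized polynomials *)

Section DpolyOrthogonal.
Context {R : realType} {a : nat}.
Variables (unif : probability (sphere R a.+1) R) (hunif : is_unif unif).
Let L := sphere_mean unif.
Let D : nat -> {poly R} := Dpoly (a%:R / 2).

(** Integrate D_n' D_m by parts and replace D_n'' by means of [Dpoly_ode]. The terms with [a.+1]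
    cancel because the dimension is [a.+1]. *)
Lemma sphere_mean_Dpoly_deriv n m :
  L ((1 - 'X^2) * ((D n)^`() * (D m)^`())) = (n * (n + a))%:R * L (D n * D m).
Proof.
have ode := Dpoly_ode (R := R) a n; rewrite -/D in ode.
have e : (1 - 'X^2) * ((D n)^`() * D m)^`() =
    a.+1%:R *: ('X * ((D n)^`() * D m)) - (n * (n + a))%:R *: (D n * D m)
    + (1 - 'X^2) * ((D n)^`() * (D m)^`()).
  apply/eqP; rewrite -subr_eq0 -!natr_mul_scale derivM; apply/eqP.
  by rewrite -[RHS](mul0r (D m)) -ode; ring.
have := sphere_mean_by_parts hunif ((D n)^`() * D m).
rewrite e sphere_meanD sphere_meanB !sphere_meanZ -/L => {}e.
by move/eqP: e; rewrite -subr_eq0 addrC !addrA addNr add0r addrC subr_eq0 => /eqP.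
Qed.

(** The left side of [sphere_mean_Dpoly_deriv] is symmetric in n and m, while the eigenvalues n (n +
    a) are pairwise distinct. *)
Lemma Dpoly_orthogonal n m : n != m -> L (D n * D m) = 0.
Proof.
move=> nm; have e1 := sphere_mean_Dpoly_deriv n m.
have e2 := sphere_mean_Dpoly_deriv m n.
rewrite [(D m)^`() * _]mulrC e1 [D m * _]mulrC in e2.
apply/eqP; have /eqP := e2; rewrite -subr_eq0 -mulrBl mulf_eq0 => /orP[|//].
rewrite subr_eq0 eqr_nat => /eqP nm'; exfalso.
by move: nm; have [//|nm|nm] := ltngtP n m; nia.
Qed.

End DpolyOrthogonal.

(** * Moment uniqueness on [-1, 1] *)

Section StepApproximation.
Context {R : realType}.

Lemma bernoulli_ineq (x : R) N : -1 <= x -> 1 + N%:R * x <= (1 + x) ^+ N.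
Proof.
move=> x1; elim: N => [|N IH]; first by rewrite mul0r addr0 expr0.
have x0 : 0 <= 1 + x by lra.
have := ler_wpM2l x0 IH; rewrite -exprS; apply: le_trans.
have := mulr_ge0 (ler0n R N) (sqr_ge0 x); rewrite -natr1; lra.
Qed.

(** Each of the n terms of 1 + s + ... + s^(n-1) is at least s^n. *)
Lemma natr_mul_expr_le (s : R) n : 0 <= s <= 1 ->
  (1 - s) * (n%:R * s ^+ n) <= 1 - s ^+ n.
Proof.
move=> /andP[s0 s1]; elim: n => [|n IH]; first by rewrite mul0r mulr0 expr0 subrr.
have sn0 : 0 <= s ^+ n by rewrite exprn_ge0.
have h : n.+1%:R * s ^+ n.+1 <= n.+1%:R * s ^+ n.
  by rewrite ler_wpM2l// exprS ler_piMl.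
have s10 : 0 <= 1 - s by lra.
have := ler_wpM2l s10 h; rewrite -natr1 exprS; lra.
Qed.

(** With r = s^2, one factor s^n keeps n s^n bounded by 1 / (1 - s), and the other tends to 0. *)
Lemma cvg_natr_mul_expr (r : R) : 0 <= r < 1 -> n%:R * r ^+ n @[n --> \oo] --> 0.
Proof.
move=> /andP[r0 r1]; pose s := Num.sqrt r.
have s0 : 0 <= s by exact: sqrtr_ge0.
have s1 : s < 1 by rewrite -sqrtr1 ltr_sqrt.
have rE : r = s * s by rewrite -expr2 sqr_sqrtr.
have sgt : 0 < 1 - s by lra.
apply: (@squeeze_cvgr _ _ _ _ (fun=> 0) (geometric (1 - s)^-1 s)).
- near=> n; rewrite mulr_ge0 ?exprn_ge0//= rE exprMn mulrA.
  rewrite ler_wpM2r ?exprn_ge0// -[leRHS]mulr1 ler_pdivlMl//.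
  have := @natr_mul_expr_le s n; rewrite s0 ltW// => /(_ isT).
  have := exprn_ge0 n s0; lra.
- exact: cvg_cst.
- by apply: cvg_geometric; rewrite ger0_norm.
Unshelve. all: by end_near. Qed.

(* With exponent [2 ^ n] the limit at [u = 1/2] would be [1/e] instead of 0. *)
Definition step_poly (u : R) (n : nat) : R := (1 - u ^+ n) ^+ (n * 2 ^ n).

Lemma step_poly_itv u n : 0 <= u <= 1 -> 0 <= step_poly u n <= 1.
Proof.
move=> /andP[u0 u1]; have un0 := exprn_ge0 n u0.
have un1 := exprn_ile1 n u0 u1.
by rewrite /step_poly exprn_ge0 ?exprn_ile1; lra.
Qed.

(** Bernoulli's inequality serves twice. Below 1/2 it gives the lower bound 1 - n (2u)^n. From 1/2
    on, (1 - u^n)(1 + u^n) <= 1 gives the upper bound 1 / (1 + n (2u)^n), which is at most 1 / (1 +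
    n). *)
Lemma cvg_step_poly u : 0 <= u <= 1 ->
  step_poly u n @[n --> \oo] --> ((u < 2^-1)%R%:R : R).
Proof.
move=> u01; have /andP[u0 u1] := u01; have [u2|u2] := ltP u 2^-1.
  apply: (@squeeze_cvgr _ _ _ _ (fun n => 1 - n%:R * (2 * u) ^+ n) (fun=> 1)).
  - near=> n; have /andP[_ ->] := step_poly_itv n u01; rewrite andbT.
    have un1 := exprn_ile1 n u0 u1.
    have := @bernoulli_ineq (- u ^+ n) (n * 2 ^ n); rewrite lerNl opprK.
    move=> /(_ un1); apply: le_trans; rewrite exprMn natrM natrX; lra.
  - rewrite -[X in _ --> X]subr0; apply: cvgB; first exact: cvg_cst.
    by apply: cvg_natr_mul_expr; lra.
  - exact: cvg_cst.
apply: (@squeeze_cvgr _ _ _ _ (fun=> 0) (@harmonic R)).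
- near=> n; have /andP[-> _] := step_poly_itv n u01 => /=.
  have un0 := exprn_ge0 n u0.
  have un1 := exprn_ile1 n u0 u1.
  rewrite /harmonic /= -[leRHS]mul1r ler_pdivlMr ?ltr0Sn//.
  have le1 : step_poly u n * (1 + u ^+ n) ^+ (n * 2 ^ n) <= 1.
    rewrite /step_poly -exprMn exprn_ile1//; nra.
  apply: le_trans le1; rewrite ler_wpM2l//.
    by have /andP[] := step_poly_itv n u01.
  apply: le_trans (bernoulli_ineq _ _); last by lra.
  rewrite -nat1r lerD2l natrM natrX -mulrA -exprMn ler_peMr ?exprn_ege1//; lra.
- exact: cvg_cst.
- exact: cvg_harmonic.
Unshelve. all: by end_near. Qed.
End StepApproximation.

(** * Functions with vanishing moments *)

Section MomentUniqueness.
Context {R : realType} {disp : measure_display} {T : measurableType disp}.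
Variables (P : probability T R) (X : T -> measurableTypeR R) (f : T -> R).
Hypothesis mX : measurable_fun setT X.
Hypothesis X1 : forall x, `|X x : R| <= 1.
Hypothesis intf : P.-integrable setT (EFin \o f).
Hypothesis mom : forall k, \int[P]_x (f x * (X x : R) ^+ k) = 0.

Lemma integrable_mul_horner (p : {poly R}) :
  P.-integrable setT (EFin \o (fun x => f x * p.[X x])).
Proof.
have [M pM] := horner_bounded p.
apply: (@integrableMl _ _ _ P setT measurableT (EFin \o f)
  (fun x => p.[X x])) => //.
  apply: (@measurableT_comp _ _ _ T (measurableTypeR R) R (horner p)) => //.
  exact: measurable_poly.
exists M; split; first exact: num_real.
by move=> N MN x _ /=; rewrite (le_trans (pM _ (X1 x)))// ltW.
Qed.

Lemma Rintegral_mul_horner0 (p : {poly R}) : \int[P]_x (f x * p.[X x]) = 0.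
Proof.
apply: (@linear_form_poly0 _ (fun p => \int[P]_x (f x * p.[X x]))) => [q r|c q|k].
- rewrite -RintegralD//; try exact: integrable_mul_horner.
  by apply: eq_Rintegral => x _; rewrite hornerD mulrDr.
- rewrite -RintegralZl//; last exact: integrable_mul_horner.
  by apply: eq_Rintegral => x _; rewrite hornerZ mulrCA.
- by rewrite -[RHS](mom k); apply: eq_Rintegral => x _; rewrite hornerXn.
Qed.

Lemma measurable_preimage (B : set (measurableTypeR R)) :
  measurable B -> measurable (X @^-1` B).
Proof. by move=> mB; rewrite -[X in measurable X]setTI; exact: mX. Qed.

(* The polynomials [step_poly u n] in [u = 1/2 + (t - c) / (2 (1 + |c|))] are
   bounded by 1 and converge to the indicator of [t < c] on [-1, 1]. *)
Lemma integral_preimage_lt0 (c : R) :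
  (\int[P]_(x in X @^-1` [set` `]-oo, c[]) (f x)%:E = 0)%E.
Proof.
pose s := (2 * (1 + `|c|))^-1.
have c0 : 0 < 1 + `|c| by rewrite ltr_pwDl.
have s0 : 0 < s by rewrite invr_gt0 mulr_gt0.
pose U : {poly R} := 2^-1%:P + s *: ('X - c%:P).
have UE t : U.[t] = 2^-1 + s * (t - c).
  by rewrite /U hornerD hornerC hornerZ hornerXsubC.
have U01 x : 0 <= U.[X x] <= 1.
  have : `|s * ((X x : R) - c)| <= 2^-1.
    rewrite normrM (gtr0_norm s0) /s invfM -mulrA ler_piMr// mulrC ler_pdivrMr//.
    by rewrite mul1r (le_trans (ler_normB _ _))// lerD2r.
  rewrite UE; move: (s * _) => z; rewrite ler_norml; lra.
have Uc x : (U.[X x] < 2^-1) = ((X x : R) < c).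
  by rewrite UE gtrDl pmulr_rlt0// subr_lt0.
pose p n : {poly R} := (1 - U ^+ n) ^+ (n * 2 ^ n).
have pE n t : (p n).[t] = step_poly U.[t] n.
  by rewrite /p horner_exp hornerD hornerN horner_exp hornerC.
pose F n x : \bar R := (f x * (p n).[X x])%:E.
pose F' x : \bar R := (f x * ((X x : R) < c)%R%:R)%:E.
have mc : measurable (X @^-1` [set` `]-oo, c[]) by exact: measurable_preimage.
have F'E : F' = (EFin \o f) \_ (X @^-1` [set` `]-oo, c[]).
  apply/funext => x; rewrite /F' patchE.
  rewrite (_ : (x \in _) = ((X x : R) < c)); last first.
    by apply/idP/idP; rewrite inE/= in_itv.
  by case: ifP => _; rewrite ?mulr1 ?mulr0.
rewrite integral_mkcond -/(EFin \o f) -F'E.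
have mf := measurable_int _ intf.
have [] := @dominated_convergence _ _ _ P setT measurableT F F'
  (fun x => `|f x|%:E).
- by move=> n; exact: measurable_int (integrable_mul_horner (p n)).
- by rewrite F'E; apply/(measurable_restrictT _ mc).1; exact: measurable_funTS.
- apply: aeW => x _; apply: cvg_EFin; first exact: nearW.
  apply: cvgMr; rewrite -Uc; under eq_fun do rewrite pE.
  exact: cvg_step_poly.
- exact: (integrable_abse intf).
- apply: aeW => x n _; rewrite lee_fin normrM ler_piMr// pE.
  by have /andP[h0 h1] := step_poly_itv n (U01 x); rewrite ger0_norm.
(* Every term of the sequence integrates [f] against a polynomial in [X], so the sequence is
   constantly zero. *)
move=> _ _; rewrite [X in X @ _ --> _](_ : _ = fun=> 0%E); last first.
  apply/funext => n; have := Rintegral_mul_horner0 (p n).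
  have /fineK e := integrable_fin_num measurableT (integrable_mul_horner (p n)).
  by rewrite /Rintegral => h; rewrite -[LHS]e h.
by move=> /cvg_lim => /(_ (@ereal_hausdorff R)) <-; rewrite lim_cst//.
Qed.

(** The open left half-lines form a generating pi-system, so Dynkin's theorem extends
    [integral_preimage_lt0] to Borel sets. Complements use the moment of order 0. *)
Lemma integral_preimage0 (B : set (measurableTypeR R)) : measurable B ->
  (\int[P]_(x in X @^-1` B) (f x)%:E = 0)%E.
Proof.
have f0 : (\int[P]_x (f x)%:E = 0)%E.
  have /fineK <- := integrable_fin_num measurableT intf.
  rewrite (_ : fine _ = 0)// -[RHS](mom 0); apply: eq_Rintegral => x _.
  by rewrite expr0 mulr1.
move=> mB; have mE := RGenInftyO.measurableE R.
apply: (@dynkin_induction _ (measurableTypeR R) _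
  (fun B => \int[P]_(x in X @^-1` B) (f x)%:E = 0)%E mE) => //.
- move=> _ _ [a ->] [b ->]; exists (Num.min a b).
  apply/seteqP; split=> x /=; rewrite !in_itv/= lt_min; first by case=> -> ->.
  by move=> /andP[].
- by move=> _ [a ->]; exact: integral_preimage_lt0.
- move=> S mS S0; rewrite -f0 -(setUv (X @^-1` S)) integral_setU_EFin//=.
  + by rewrite S0 add0e.
  + exact: measurable_preimage.
  + by apply: measurableC; exact: measurable_preimage.
  + by rewrite setUv; exact/measurable_EFinP/(measurable_int _ intf).
  + exact/disj_setPCl.
- move=> F mF tF F0; rewrite preimage_bigcup integral_bigcup//.
  + by apply: eseries0 => n _ _; exact: F0.
  + apply/trivIsetP => i j _ _ ij.
    by move/trivIsetP: tF => /(_ i j I I ij) e;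
      rewrite -preimage_setI e preimage_set0.
  + by move=> n; exact: measurable_preimage.
  + apply: (integrableS measurableT) => //.
    by apply: bigcupT_measurable => n; exact: measurable_preimage.
- exact: (eq_ind _ (fun M => M B) mB _ mE).
Qed.
End MomentUniqueness.

(** * The mixture density *)

Section DensityProbability.
Context {R : realType} {disp : measure_display} {T : measurableType disp}.
Variables (mu : probability T R) (f : T -> R).
Hypothesis mf : measurable_fun setT f.
Hypothesis f0 : forall x, 0 <= f x.
Hypothesis f1 : (\int[mu]_x (f x)%:E = 1)%E.

Definition density_measure (A : set T) : \bar R := (\int[mu]_(x in A) (f x)%:E)%E.

Let density0 : density_measure set0 = 0%E.
Proof. exact: integral_set0. Qed.

Let density_ge0 A : (0 <= density_measure A)%E.
Proof. by apply: integral_ge0 => x _; rewrite lee_fin. Qed.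

Let density_sigma_additive : semi_sigma_additive density_measure.
Proof.
move=> /= F mF tF mUF; rewrite /density_measure ge0_integral_bigcup//.
- apply: is_cvg_ereal_nneg_natsum_cond => n _ _.
  by apply: integral_ge0 => x _; rewrite lee_fin.
- by apply/measurable_EFinP; exact: measurable_funTS.
- by move=> x _; rewrite lee_fin.
Qed.

HB.instance Definition _ := isMeasure.Build _ _ _
  density_measure density0 density_ge0 density_sigma_additive.

HB.instance Definition _ :=
  @Measure_isProbability.Build _ _ R density_measure f1.

Lemma density_probability : exists Q : probability T R, has_density mu Q f.
Proof. by exists density_measure. Qed.

End DensityProbability.

(** * Span and norms of the normalized polynomials *)

Section DpolySpan.
Context {R : realType} (a : nat).
Let D : nat -> {poly R} := Dpoly (a%:R / 2).

(** The induction on k shows that [l] kills X^k D_n for all n at once: [DpolySS] writes X D_(n+1) as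
    a combination of D_(n+2) and D_n, and X D_0 is D_1. *)
Lemma linear_form_Dpoly0 (l : {poly R} -> R) :
  (forall p q, l (p + q) = l p + l q) -> (forall c p, l (c *: p) = c * l p) ->
  (forall n, l (D n) = 0) -> forall k, l 'X^k = 0.
Proof.
move=> lD lZ lDn k; rewrite -[in 'X^_](mulr1 'X^k) -(Dpoly0 (R := R) a) -/D.
elim: k 0%N => [|k IH] [|n]; rewrite ?expr0 ?mul1r//.
  by have := IH 1%N; rewrite /D Dpoly0 Dpoly1 mulr1 exprSr.
rewrite exprSr -mulrA; have c0 : (2 * n.+1 + a)%:R != 0 :> R by rewrite pnatr_eq0.
apply: (mulfI c0); rewrite mulr0 -lZ scalerAr -natr_mul_scale.
have -> : (2 * n.+1 + a)%:R * ('X * D n.+1) =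
    (n.+1 + a)%:R *: D n.+2 + n.+1%:R *: D n.
  by rewrite -!natr_mul_scale /D DpolySS subrK.
by rewrite mulrDr -!scalerAr lD !lZ !IH !mulr0 addr0.
Qed.

End DpolySpan.

Section DpolyNorm.
Context {R : realType} {a : nat}.
Variables (unif : probability (sphere R a.+1) R) (hunif : is_unif unif).
Let L := sphere_mean unif.
Let D : nat -> {poly R} := Dpoly (a%:R / 2).

Lemma sphere_mean_Dpoly n : L (D n.+1) = 0.
Proof. by rewrite -[D n.+1]mulr1 -(Dpoly0 (R := R) a);
  exact: Dpoly_orthogonal. Qed.

(** The recurrence at two consecutive indices, with orthogonality, evaluates the mean of X D_(n+1)
    D_(n+2) as a positive multiple of either squared norm, so positivity propagates. *)
Lemma sphere_mean_Dpoly_sq_gt0 n : 0 < L (D n * D n).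
Proof.
case: n => [|n]; first by rewrite /D Dpoly0 mulr1 /L sphere_mean1.
elim: n => [|n IH].
  rewrite /D Dpoly1 -expr2 /L.
  (* At q = 0 the moment recurrence says that (a + 2) times the mean of X^2 is 1. *)
  have := sphere_mean_recurrence hunif 0.
  rewrite muln0 muln1 expr0 sphere_mean1 mul1r => e.
  have : (a.+1%:R + 1) * sphere_mean unif 'X^2 = 1 by rewrite mulrDl -e; ring.
  by move=> e1; rewrite -(@pmulr_rgt0 _ (a.+1%:R + 1)) ?e1// ltr_wpDl.
have e1 : (2 * n.+1 + a)%:R * L ('X * D n.+1 * D n.+2) =
    (n.+1 + a)%:R * L (D n.+2 * D n.+2).
  have e := DpolySS (R := R) a n; rewrite -/D in e.
  rewrite -!sphere_meanZ -!natr_mul_scale -/L.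
  have -> : (2 * n.+1 + a)%:R * ('X * D n.+1 * D n.+2) =
    (n.+1 + a)%:R * (D n.+2 * D n.+2) + n.+1%:R * (D n * D n.+2).
    by rewrite [(n.+1 + a)%:R * _]mulrA e; ring.
  rewrite /L sphere_meanD [X in _ + sphere_mean _ X]natr_mul_scale sphere_meanZ.
  by rewrite (Dpoly_orthogonal hunif) ?mulr0 ?addr0//; lia.
have e2 : (2 * n.+2 + a)%:R * L ('X * D n.+1 * D n.+2) =
    n.+2%:R * L (D n.+1 * D n.+1).
  have e := DpolySS (R := R) a n.+1; rewrite -/D in e.
  rewrite -!sphere_meanZ -!natr_mul_scale -/L.
  have -> : (2 * n.+2 + a)%:R * ('X * D n.+1 * D n.+2) =
    (n.+2 + a)%:R * (D n.+3 * D n.+1) + n.+2%:R * (D n.+1 * D n.+1).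
    by rewrite [(n.+2 + a)%:R * _]mulrA e; ring.
  rewrite /L sphere_meanD [X in sphere_mean _ X + _]natr_mul_scale sphere_meanZ.
  by rewrite (Dpoly_orthogonal hunif) ?mulr0 ?add0r//; lia.
have p1 : 0 < L ('X * D n.+1 * D n.+2).
  by rewrite -(@pmulr_rgt0 _ (2 * n.+2 + a)%:R) ?ltr0n// e2 mulr_gt0.
by rewrite -(@pmulr_rgt0 _ (n.+1 + a)%:R) ?ltr0n// -e1 mulr_gt0.
Qed.

End DpolyNorm.

(** * Expansion of the density *)

Section MixtureDensity.
Context {R : realType} {a : nat}.
Variables (unif : probability (sphere R a.+1) R) (hunif : is_unif unif).
Variable eta : sphere R a.+1.
Let lambda : R := a%:R / 2.
Let D : nat -> {poly R} := Dpoly lambda.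
Let L := sphere_mean unif.
Let X (x : sphere R a.+1) : measurableTypeR R := sdot eta x.

Variable g : R -> R.
Hypothesis g2 : g \in Lfun (nu unif) 2%:E.
Hypothesis g1 : (\int[unif]_x (g (X x))%:E = 1)%E.
Hypothesis beta_ge0 : forall n, (1 <= n)%N -> 0 <= beta (nu unif) lambda g n.
Hypothesis beta_total_le1 : (beta_total (nu unif) lambda g <= 1)%E.
Let w := weight (nu unif) lambda g.

(** The case 0 is separate because [1 + D 0] would be the constant 2. *)
Definition mixture_poly n : {poly R} := if n == 0%N then 1 else 1 + D n.
Let e := mixture_poly.

Lemma mixture_poly_itv n t : -1 <= t <= 1 -> 0 <= (e n).[t] <= 2.
Proof.
move=> t1; rewrite /e /mixture_poly; case: eqP => _; rewrite ?hornerD hornerC.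
  by lra.
by have := Dpoly_le1 a n t1; rewrite ler_norml -/lambda -/D; lra.
Qed.

Lemma mixture_poly_ge0 n x : 0 <= (e n).[X x].
Proof. by have /andP[] := mixture_poly_itv n (sdot_itv eta x). Qed.

Lemma beta_total_ge0 : (0 <= beta_total (nu unif) lambda g)%E.
Proof. by apply: nneseries_ge0 => n _ _; rewrite lee_fin. Qed.

Lemma beta_totalE : beta_total (nu unif) lambda g =
  (fine (beta_total (nu unif) lambda g))%:E.
Proof.
rewrite fineK// ge0_fin_numE; last exact: beta_total_ge0.
exact: le_lt_trans beta_total_le1 (ltry _).
Qed.

Lemma weight_ge0 n : 0 <= w n.
Proof.
rewrite /w /weight; case: eqP => [_|/eqP n0]; last by rewrite beta_ge0// lt0n.
by rewrite subr_ge0 -lee_fin -beta_totalE.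
Qed.

Lemma weight_sum : (\sum_(0 <= n <oo) (w n)%:E = 1)%E.
Proof.
rewrite nneseries_recl//; last by move=> n _; rewrite lee_fin weight_ge0.
have -> : (\sum_(1 <= n <oo) (w n)%:E)%E = beta_total (nu unif) lambda g.
  apply: congr_lim; apply/funext => N; apply: eq_big_nat => n /andP[n1 _].
  by rewrite /w /weight gtn_eqF// ger0_norm ?beta_ge0.
by rewrite /w /weight eqxx beta_totalE -EFinD subrK.
Qed.

(* The absolute values only matter outside [-1, 1], where [e n] may be
  negative. *)
Definition mixture_density (t : R) : \bar R :=
  (\sum_(0 <= n <oo) (w n * `|(e n).[t]|)%:E)%E.
Let S := mixture_density.

Lemma mixture_density_ge0 t : (0 <= S t)%E.
Proof. by apply: nneseries_ge0 => n _ _; rewrite lee_fin mulr_ge0 ?weight_ge0.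
  Qed.

Lemma measurable_mixture_density : measurable_fun setT S.
Proof.
apply: (@ge0_emeasurable_sum _ _ _ setT
  (fun n t => (w n * `|(e n).[t]|)%:E) xpredT).
  by move=> n t _ _; rewrite lee_fin mulr_ge0 ?weight_ge0.
move=> n _; apply/measurable_EFinP; apply: measurable_funM => //.
by apply: measurableT_comp => //; exact: measurable_poly.
Qed.

Lemma mixture_density_le2 x : (S (X x) <= 2%:E)%E.
Proof.
rewrite -[leRHS]mule1 -weight_sum -nneseriesZl; last first.
  by move=> n _; rewrite lee_fin weight_ge0.
apply: lee_nneseries => [n _ _|n _].
  by rewrite lee_fin mulr_ge0 ?weight_ge0.
rewrite -EFinM lee_fin mulrC ler_wpM2r ?weight_ge0// ger0_norm
  ?mixture_poly_ge0//.
by have /andP[] := mixture_poly_itv n (sdot_itv eta x).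
Qed.

Lemma mixture_densityE x : S (X x) = (fine (S (X x)))%:E.
Proof.
rewrite fineK// ge0_fin_numE ?mixture_density_ge0//.
exact: le_lt_trans (mixture_density_le2 x) (ltry _).
Qed.

(** All terms are nonnegative on the sphere, so sum and integral commute by monotone convergence.
    The factor [q] is [e n] when testing the mixture and 1 in the final expansion. *)
Lemma integral_mixture_density_mul (A : set (sphere R a.+1)) (q : {poly R}) :
  measurable A -> (forall x, 0 <= q.[X x]) ->
  (\int[unif]_(x in A) (S (X x) * (q.[X x])%:E) =
   \sum_(0 <= n <oo) (w n)%:E * \int[unif]_(x in A) ((e n * q).[X x])%:E)%E.
Proof.
move=> mA q0; pose F n x : \bar R := ((w n)%:E * ((e n * q).[X x])%:E)%E.
have eq0 n x : (0 <= ((e n * q).[X x])%:E)%E.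
  by rewrite lee_fin hornerM mulr_ge0 ?mixture_poly_ge0.
have mq n : measurable_fun A (fun x => ((e n * q).[X x])%:E).
  by apply/measurable_EFinP; apply: measurable_funTS;
    exact: measurable_horner_sdot.
transitivity (\int[unif]_(x in A) (\sum_(0 <= n <oo) F n x))%E.
  apply: eq_integral => x _; rewrite muleC -nneseriesZl; last first.
    by move=> n _; rewrite lee_fin mulr_ge0 ?weight_ge0.
  apply: congr_lim; apply/funext => N; apply: eq_bigr => n _.
  rewrite /F -!EFinM hornerM ger0_norm ?mixture_poly_ge0//; congr (_%:E); ring.
rewrite integral_nneseries//.
- apply: congr_lim; apply/funext => N; apply: eq_bigr => n _.
  by rewrite ge0_integralZl_EFin// weight_ge0.
- by move=> n; apply: emeasurable_funM.
- by move=> n x _; rewrite mule_ge0// lee_fin weight_ge0.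
Qed.

Let mX : measurable_fun setT X.
Proof. exact: measurable_sdot. Qed.

Let X1 x : `|X x : R| <= 1.
Proof. exact: sdot_le1. Qed.

Lemma integrable_density : unif.-integrable setT (EFin \o (fun x => g (X x))).
Proof.
have : g \in Lfun (nu unif) 1.
  by apply: (Lfun_subset12 _ g2); rewrite fin_num_measure.
move/Lfun1_integrable => gi; have mg := measurable_int _ gi.
by have /integrable_sdotP := gi; apply.
Qed.

Lemma measurable_density : measurable_fun setT g.
Proof. by have := sub_Lfun_mfun g2; rewrite inE. Qed.

Lemma inner_sdot (p : {poly R}) :
  inner (nu unif) g (horner p) = \int[unif]_x (g (X x) * p.[X x]).
Proof.
rewrite /inner (@Rintegral_sdot _ _ _ hunif eta (fun t => g t * p.[t]))//.
  by apply: measurable_funM; [exact: measurable_density|exact: measurable_poly].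
exact: (integrable_mul_horner mX X1 integrable_density).
Qed.

Lemma beta_sphere_mean n :
  beta (nu unif) lambda g n * L (D n * D n) = inner (nu unif) g (horner (D n)).
Proof.
have h0 := sphere_mean_Dpoly_sq_gt0 hunif n; rewrite -/D -/L in h0.
have hE : L (D n * D n) = inner (nu unif) (horner (D n)) (horner (D n)).
  rewrite /inner (@Rintegral_sdot _ _ _ hunif north
    (fun t => (D n).[t] * (D n).[t]))//.
  - by apply: eq_Rintegral => x _; rewrite hornerM.
  - by apply: measurable_funM; exact: measurable_poly.
  - by have := integrable_horner_sdot unif north (D n * D n);
      under eq_fun do rewrite hornerM.
by rewrite /beta /norm2 -hE sqr_sqrtr ?ltW// divfK// gt_eqF.
Qed.

(** Expand the product: the D_k with k >= 1 have mean zero and are orthogonal to each other. The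
    factor [n != 0] reflects that [e 0] has no D term. *)
Lemma sphere_mean_mixture_polyM m n :
  L (e m * e n) = 1 + (m == n)%:R * ((n != 0%N)%:R * L (D n * D n)).
Proof.
have L1 : L 1 = 1 by exact: sphere_mean1.
have LD0 k : L (D k.+1) = 0 by exact: sphere_mean_Dpoly.
case: m n => [|m] [|n]; rewrite /e /mixture_poly/= ?mul1r ?mulr1 ?mul0r ?mulr0
  ?addr0//.
- by rewrite /L sphere_meanD -/L L1 LD0 addr0.
- by rewrite /L sphere_meanD -/L L1 LD0 addr0.
rewrite mulrDl mul1r mulrDr mulr1 /L !sphere_meanD -/L L1 !LD0 addr0 add0r eqSS.
have [->|mn] := eqVneq m n; first by rewrite mul1r.
by rewrite mul0r [L _](Dpoly_orthogonal hunif).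
Qed.

Lemma integral_horner_sdot (p : {poly R}) :
  (\int[unif]_x (p.[X x])%:E = (L p)%:E)%E.
Proof.
rewrite /L -(sphere_mean_sdot hunif eta) /Rintegral fineK//.
by apply: integrable_fin_num => //; exact: integrable_horner_sdot.
Qed.

Lemma nneseries_add_delta (u : nat -> R) n h : (forall m, 0 <= u m) -> 0 <= h ->
  (\sum_(0 <= m <oo) (u m)%:E * (1 + (m == n)%:R * h)%:E =
   \sum_(0 <= m <oo) (u m)%:E + (u n * h)%:E)%E.
Proof.
move=> u0 h0; rewrite [LHS](nneseriesD1 (n := n))//; last first.
  by move=> m _; rewrite -EFinM lee_fin mulr_ge0// addr_ge0// mulr_ge0.
rewrite [in RHS](nneseriesD1 (n := n))//; last by move=> m _; rewrite lee_fin.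
rewrite eqxx mul1r -EFinM mulrDr mulr1 EFinD -!addeA; congr (_ + _)%E.
rewrite [RHS]addeC; congr (_ + _)%E; apply: eq_eseriesr => m /negPf mn.
by rewrite mn mul0r addr0 mule1.
Qed.

(* Testing against [1 + D n] instead of [D n] keeps all terms nonnegative. *)
Lemma integral_mixture_density n :
  (\int[unif]_x (S (X x) * ((e n).[X x])%:E) =
   (1 + (n != 0%N)%:R * inner (nu unif) g (horner (D n)))%:E)%E.
Proof.
rewrite integral_mixture_density_mul//; last exact: mixture_poly_ge0.
under eq_eseriesr do rewrite integral_horner_sdot sphere_mean_mixture_polyM.
rewrite nneseries_add_delta ?weight_sum.
(* For n = 0 the boolean factor is zero, so [w 0], which is not a coefficient [beta], drops out. *)
- rewrite -EFinD; congr (1 + _)%:E; rewrite mulrCA -beta_sphere_mean /w /weight.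
  by case: eqP; rewrite ?mul0r.
- exact: weight_ge0.
- by rewrite mulr_ge0// ltW//; exact: sphere_mean_Dpoly_sq_gt0.
Qed.

Let f x : R := g (X x) - fine (S (X x)).

Lemma integrable_fine_mixture :
  unif.-integrable setT (EFin \o (fun x => fine (S (X x)))).
Proof.
apply: (@integrable_bounded _ _ _ _ _ 2).
  apply: (@measurableT_comp _ _ _ (sphere R a.+1) (measurableTypeR R) _
    (fine \o S)) => //.
  by apply: measurableT_comp => //; exact: measurable_mixture_density.
move=> x; rewrite ger0_norm ?fine_ge0 ?mixture_density_ge0//.
by rewrite -lee_fin -mixture_densityE mixture_density_le2.
Qed.

Lemma integrable_density_gap : unif.-integrable setT (EFin \o f).
Proof.
rewrite (_ : EFin \o f =
  (EFin \o (fun x => g (X x))) \- (EFin \o (fun x => fine (S (X x)))))%E//.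
by apply: integrableB => //;
  [exact: integrable_density|exact: integrable_fine_mixture].
Qed.

(** Against 1 + D_n with n >= 1, both [g] and the mixture give 1 + <g, D_n>; against [e 0] both give
    1. For [g] the summand 1 is its total mass [g1]. *)
Lemma density_gap_mixture_poly n : \int[unif]_x (f x * (e n).[X x]) = 0.
Proof.
under eq_Rintegral do rewrite mulrBl.
rewrite RintegralB//; [|exact: (integrable_mul_horner mX X1 integrable_density)
  |exact: (integrable_mul_horner mX X1 integrable_fine_mixture)].
have -> : \int[unif]_x (fine (S (X x)) * (e n).[X x]) =
    1 + (n != 0%N)%:R * inner (nu unif) g (horner (D n)).
  rewrite -[RHS]/(fine _%:E) -integral_mixture_density /Rintegral; congr fine.
  by apply: eq_integral => x _; rewrite EFinM -mixture_densityE.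
have G1 : \int[unif]_x g (X x) = 1 by rewrite /Rintegral g1.
rewrite /e /mixture_poly; case: eqP => [_|_] /=.
  under eq_Rintegral do rewrite hornerC mulr1.
  by rewrite G1 mul0r addr0 subrr.
under eq_Rintegral do rewrite hornerD hornerC mulrDr mulr1.
rewrite RintegralD//; [|exact: integrable_density
  |exact: (integrable_mul_horner mX X1 integrable_density)].
by rewrite G1 mul1r inner_sdot subrr.
Qed.

(** Subtracting the case n = 0 passes from 1 + D_n to D_n, and [linear_form_Dpoly0] passes on to
    monomials. *)
Lemma density_gap_moment k : \int[unif]_x (f x * (X x : R) ^+ k) = 0.
Proof.
pose l (p : {poly R}) := \int[unif]_x (f x * p.[X x]).
have intl p := integrable_mul_horner mX X1 integrable_density_gap p.
have lD p q : l (p + q) = l p + l q.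
  by rewrite /l -RintegralD//; apply: eq_Rintegral => x _; rewrite hornerD mulrDr.
have lZ c p : l (c *: p) = c * l p.
  by rewrite /l -RintegralZl//; apply: eq_Rintegral => x _;
    rewrite hornerZ mulrCA.
have lX : l 'X^k = 0.
  apply: (@linear_form_Dpoly0 R a l lD lZ) => n.
  have l1 : l 1 = 0 := density_gap_mixture_poly 0.
  case: n => [|n]; first by rewrite Dpoly0.
  have : l (1 + D n.+1) = 0 := density_gap_mixture_poly n.+1.
  by rewrite lD l1 add0r.
by rewrite -[RHS]lX; apply: eq_Rintegral => x _; rewrite hornerXn.
Qed.

(** Moment uniqueness makes the integral of [h] over every Borel set vanish under [nu], so [h] is
    zero almost everywhere on the line. The exceptional null set is then pulled back to the
    sphere. *)
Lemma density_ae_mixture : {ae unif, forall x, (g (X x))%:E = S (X x)}.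
Proof.
pose h t : R := g t - fine (S t).
have mh : measurable_fun setT h.
  apply: measurable_funB; first exact: measurable_density.
  by apply: measurableT_comp => //; exact: measurable_mixture_density.
have mEh : measurable_fun setT (EFin \o h) by exact/measurable_EFinP.
have inth : (nu unif).-integrable setT (EFin \o h).
  by apply/(integrable_sdotP hunif eta) => //; exact: integrable_density_gap.
have : ae_eq (nu unif) setT (EFin \o h) (cst 0%E).
  apply: integral_ae_eq => // B _ mB; rewrite integral_cst// mul0e.
  rewrite (integral_sdot hunif (eta := eta))//.
    exact: (integral_preimage0 mX X1 integrable_density_gap density_gap_moment).
  apply: (integrableS measurableT) integrable_density_gap => //.
  exact: measurable_preimage.
move=> [N [mN N0 hN]]; exists (X @^-1` N); split.
- exact: measurable_preimage.
- by rewrite -[LHS](nuE hunif).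
- move=> x /= gS; apply: hN => /= /(_ I) [] /eqP; rewrite subr_eq0 => /eqP e0.
  by apply: gS; rewrite e0 -mixture_densityE.
Qed.

Lemma integral_density_mixture (A : set (sphere R a.+1)) : measurable A ->
  (\int[unif]_(x in A) (g (X x))%:E =
   \sum_(0 <= n <oo) (w n)%:E * \int[unif]_(x in A) ((e n).[X x])%:E)%E.
Proof.
move=> mA.
(* The constant polynomial 1 is inserted as the test factor for [integral_mixture_density_mul]. *)
transitivity (\int[unif]_(x in A) (S (X x) * ((1 : {poly R}).[X x])%:E))%E.
  apply: ae_eq_integral => //.
  - exact: measurable_funTS (measurable_int _ integrable_density).
  - apply: emeasurable_funM; apply: measurable_funTS.
      apply: (@measurableT_comp _ _ _ (sphere R a.+1) (measurableTypeR R)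
        _ S) => //.
      exact: measurable_mixture_density.
    by apply/measurable_EFinP; exact: measurable_horner_sdot.
  - apply: filterS density_ae_mixture => x e0 _.
    by rewrite e0 hornerC mule1.
rewrite integral_mixture_density_mul//; last by move=> x; rewrite hornerC.
by apply: eq_eseriesr => n _; rewrite mulr1.
Qed.

End MixtureDensity.

(** * The discrete mixture expansion *)

Theorem proposition7 (R : realType) (d : nat) (hd : (1 <= d)%N)
    (lambda : R) (hlambda : lambda = (d%:R - 1) / 2%:R)
    (unif : probability (sphere R d) R) (hunif : is_unif unif)
    (I : interval R) (hI : [set` I] `<=` [set rho | 0 <= rho])
    (g : R -> R -> R)
    (hg : forall rho, rho \in I -> g rho \in Lfun (nu unif) 2%:E)
    (hbeta : forall rho, rho \in I ->
       (beta_total (nu unif) lambda (g rho) < +oo)%E)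
    (P : sphere R d -> R -> probability (sphere R d) R)
    (hP : forall eta rho, rho \in I ->
       has_density unif (P eta rho) (fun x => g rho (sdot eta x)))
    (rho : R) (hrho : rho \in I)
    (hbeta0 : forall n : nat, (1 <= n)%N ->
       0 <= beta (nu unif) lambda (g rho) n)
    (hbeta1 : (beta_total (nu unif) lambda (g rho) <= 1)%E)
    (eta : sphere R d) :
  exists Delta : nat -> probability (sphere R d) R,
    (forall n, is_Delta unif lambda n eta (Delta n)) /\
    mixture_expansion (P eta rho)
      (weight (nu unif) lambda (g rho)) Delta.
Proof.
case: d hd hlambda unif hunif hg hbeta P hP hbeta0 hbeta1 eta =>
  [//|a] _ hlambda unif hunif hg hbeta P hP hbeta0 hbeta1 eta.
have {hlambda} le : lambda = a%:R / 2 by rewrite hlambda -natr1 addrK.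
subst lambda.
have density n : exists Q : probability (sphere R a.+1) R,
    has_density unif Q (fun x => (@mixture_poly R a n).[sdot eta x]).
  apply: density_probability.
  - exact: measurable_horner_sdot.
  - exact: mixture_poly_ge0.
  - rewrite integral_horner_sdot//; congr (_%:E).
    (* Since [mixture_poly 0] is 1, the product formula with second index 0 gives total mass 1. *)
    by have := sphere_mean_mixture_polyM hunif n 0; rewrite mulr1 mul0r mulr0 addr0.
have [Delta hDelta] := choice density.
(* The mass of P fixes the coefficient of index 0, which the [beta] of positive index do not see. *)
have g1 : (\int[unif]_x (g rho (sdot eta x))%:E = 1)%E.
  by rewrite -(hP eta rho hrho setT measurableT) probability_setT.
exists Delta; split=> [n|].
  rewrite /is_Delta; case: eqP => [->|/eqP n0] A mA; rewrite hDelta//.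
    under eq_integral do rewrite hornerC.
    by rewrite integral_cst// mul1e.
  by apply: eq_integral => x _; rewrite /mixture_poly (negPf n0) hornerD hornerC.
split.
- exact: weight_ge0.
- exact: weight_sum.
move=> A mA; rewrite (hP eta rho hrho A mA).
rewrite (integral_density_mixture hunif (hg _ hrho) g1 hbeta0 hbeta1)//.
by apply: eq_eseriesr => n _; rewrite hDelta.
Qed.
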